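(* Let $S(X)=\sum_j a_jX^j$ and $T(X)=\sum_i b_iX^i$ be two power series with coefficients in $\mathbb{K}$, and let $x\in\mathbb{K}$ be such that: (i) $S(X)$ converges at $x$, with sum $S(x)=k$, and consequently also $\sum_j|a_j||x^j|$ converges, with sum $\bar k$; (ii) $T(X)$ converges at $\bar k=\sum_j|a_j||x^j|$. Define $c_{ij}\in\mathbb{K}$ for $i,j\in\mathbb{N}$ by $c_{00}=1$, $c_{0j}=0$ for all $j\neq 0$, and $c_{i+1,j}=c_{i0}a_j+c_{i1}a_{j-1}+\cdots+c_{ij}a_0$. Then: (i) for every $j$, the series $d_j=\sum_i b_ic_{ij}$ converges in $\mathbb{K}$; (ii) $T(k)=\sum_j d_jx^j$.
   Context: $\mathbb{K}$ is a non-Archimedean ordered field (i.e. it contains an element larger than every integer), equipped with its order topology, which is (Cauchy) complete and has a countable basis of neighbourhoods of $0$. $|x|=\max(x,-x)\in\mathbb{K}$. $\mathbb{N}=\{0,1,2,\dots\}$; all series are indexed from $0$, and $x^0=1$. A series in $\mathbb{K}$ converges if its sequence of partial sums converges. A power series $\sum_n a_nX^n$ converges at $x\in\mathbb{K}$ if $\sum_n a_nx^n$ converges in $\mathbb{K}$. An equality between series means that the series converge and their sums are equal; in particular $T(k)=\sum_i b_ik^i$. The $d_j$ are called the expected coefficients of the formal substitution $T(S(X))$. *)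

(* Defs.v *)
From HB Require Import structures.
From mathcomp Require Import all_boot all_order all_algebra.
From mathcomp Require Import all_classical all_reals all_analysis.

Set Implicit Arguments.
Unset Strict Implicit.
Unset Printing Implicit Defensive.

Import Order.TTheory GRing.Theory Num.Theory.
Import numFieldNormedType.Exports.

Local Open Scope classical_set_scope.
Local Open Scope ring_scope.

(* An ordered field is a [realFieldType];
   the topology MathComp-Analysis puts on it, generated by the balls
   `|x - y| < e with e > 0 in the field itself, is its order topology
   ([real_order_nbhsE]), and its uniform structure is the additive one. *)

Definition non_archimedean (K : realFieldType) : Prop :=
  exists w : K, forall n : int, n%:~R < w.

(* Cauchy sequences suffice: in the presence of a countable neighbourhood
   basis of 0 this is the same as convergence of all Cauchy filters. *)
Definition cauchy_complete (K : realFieldType) : Prop :=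
  forall u : nat -> K, cauchy (u @ \oo) -> cvgn u.

Definition countable_nbhs_basis0 (K : realFieldType) : Prop :=
  exists2 B : set (set K), countable B & nbhs (0 : K) = filter_from B id.

(* A power series is its sequence of coefficients; [power_terms a x] is the
   sequence of terms of the series at x. *)
Definition power_terms (K : realFieldType) (a : nat -> K) (x : K) : nat -> K :=
  fun n => a n * x ^+ n.

Definition abs_power_terms (K : realFieldType) (a : nat -> K) (x : K) :
    nat -> K :=
  fun n => `|a n| * `|x ^+ n|.

(* [limn] is total, so equality of sums has to ask for both convergences. *)
Definition eq_series (K : realFieldType) (u v : nat -> K) : Prop :=
  [/\ cvgn (series u), cvgn (series v) & limn (series u) = limn (series v)].

(* The coefficient c_(i,j) of X^j in S(X)^i. *)
Fixpoint pow_coef (K : realFieldType) (a : nat -> K) (i j : nat) : K :=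
  if i is i'.+1 then \sum_(l < j.+1) pow_coef a i' l * a (j - l)%N
  else (j == 0%N)%:R.

Definition expected_terms (K : realFieldType) (a b : nat -> K) (j : nat) :
    nat -> K :=
  fun i => b i * pow_coef a i j.

(* Meaningful only when [series (expected_terms a b j)] converges. *)
Definition expected_coef (K : realFieldType) (a b : nat -> K) (j : nat) : K :=
  limn (series (expected_terms a b j)).

(* Main.v *)
(* Let w exceed every natural number. A finite sum whose terms are all at most
   d in absolute value is at most d * w, so a series converges as soon as its
   terms tend to 0, and a double family whose entries are small outside a
   finite square can be summed by rows or by columns. Applied to
   u_i v_(j-i) this gives Cauchy products, hence S(x)^i = sum_j c_ij x^j.
   If |a_l y^l| <= M for all l <= j, then
   |c_ij y^j| <= (j+1)^i M^i <= w M^i, uniformly in i and j. With y = x and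
   M = kbar this makes b_i c_ij x^j small outside a finite square, and the
   theorem is the exchange of summations for that family. The coefficients d_j
   converge by the same bound at a small y > 0, which also covers x = 0; if
   kbar = 0 then a_0 = 0 and c_ij vanishes for i > j. *)
Require Import Defs.
From HB Require Import structures.
From mathcomp Require Import all_boot all_order all_algebra.
From mathcomp Require Import all_classical all_reals all_analysis.
From mathcomp Require Import zify.

Set Implicit Arguments.
Unset Strict Implicit.
Unset Printing Implicit Defensive.

Import Order.TTheory GRing.Theory Num.Theory.
Import numFieldNormedType.Exports.

Local Open Scope classical_set_scope.
Local Open Scope ring_scope.

(** * Null double families and elementary facts on series *)

Section Series.

Variable K : realFieldType.

Implicit Types (u v : nat -> K) (t : nat -> nat -> K) (d e l : K).

Lemma null_norm_le u e : u @ \oo --> 0 -> 0 < e ->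
  exists N, forall n, (N <= n)%N -> `|u n| <= e.
Proof. by move=> /cvgr0Pnorm_le u0 /u0[N _ uN]; exists N. Qed.

(** This is convergence to 0 along the cofinite filter on pairs of indices. *)
Definition double_null t := forall e, 0 < e ->
  exists N, forall i j, (N <= i)%N || (N <= j)%N -> `|t i j| <= e.

Lemma double_null_tr t : double_null t -> double_null (fun i j => t j i).
Proof.
by move=> t0 e /t0[N tN]; exists N => i j; rewrite orbC; exact: tN.
Qed.

(** The bound [u i] settles all rows from some [N] on; the [N] remaining rows are finitely many null
    sequences, so one index serves them all. *)
Lemma double_null_rows t u : u @ \oo --> 0 ->
  (forall i j, `|t i j| <= u i) -> (forall i, t i @ \oo --> 0) -> double_null t.
Proof.
move=> u0 tu t0 e e0.
have [N uN] := null_norm_le u0 e0.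
have [M _ tM] : \forall j \near \oo, forall i : 'I_N, `|t i j| <= e.
  by apply: filter_forall => i; move/cvgr0Pnorm_le: (t0 i); exact.
exists (maxn N M) => i j; rewrite !geq_max.
have [Ni _|iN /= /andP[_ Mj]] := leqP N i; last exact: (tM j Mj (Ordinal iN)).
by apply: le_trans (tu i j) _; apply: le_trans (ler_norm _) (uN i Ni).
Qed.

Lemma series_mull x u l : series u @ \oo --> l ->
  series (fun n => x * u n) @ \oo --> x * l.
Proof.
move=> ul; have -> : series (fun n => x * u n) = (fun n => x * series u n).
  by apply/funext => n; rewrite /series/= mulr_sumr.
exact: cvgMl_tmp.
Qed.

Lemma series_shift u l p : series u @ \oo --> l ->
  series (fun n => if (p <= n)%N then u (n - p)%N else 0) @ \oo --> l.
Proof.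
move=> ul; rewrite -(cvg_shiftn p).
suff -> : [sequence series (fun k => if (p <= k)%N then u (k - p)%N else 0)
    (n + p)%N]_n = series u by [].
apply/funext => n; rewrite /series/= (@big_cat_nat _ _ _ p) ?leq_addl//=.
rewrite big_nat_cond big1 ?add0r => [|i /andP[/andP[_ ip] _]]; last first.
  by rewrite leqNgt ip.
rewrite -{1}(add0n p) big_addn addnK.
by apply: eq_bigr => i _; rewrite leq_addl addnK.
Qed.

Lemma series_finite u n : (forall i, (n <= i)%N -> u i = 0) ->
  series u @ \oo --> \sum_(i < n) u i.
Proof.
move=> un; apply: cvg_near_cst; exists n => // m /= nm.
rewrite -(big_mkord xpredT) /series/= (@big_cat_nat _ _ _ n)//=.
by rewrite [X in _ + X]big_nat_cond [X in _ + X]big1 ?addr0// => i /andP[/andP[/un]].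
Qed.

Lemma null_bounded u : u @ \oo --> 0 ->
  exists2 B, 0 < B & forall n, `|u n| <= B.
Proof.
move=> u0; have [B [Br uB]] := cvg_seq_bounded (cvgP _ u0).
exists (`|B| + 1) => [|n]; first by rewrite ltr_wpDl.
by apply: uB => //; rewrite (le_lt_trans (ler_norm B))// ltrDl.
Qed.

(** * Bounds on the coefficients of the powers of a series *)

Lemma pow_coef_power_terms (a : nat -> K) (x : K) i j :
  pow_coef a i.+1 j * x ^+ j =
  \sum_(l < j.+1) power_terms (pow_coef a i) x l * power_terms a x (j - l)%N.
Proof.
rewrite /= mulr_suml; apply: eq_bigr => l _.
by rewrite /power_terms mulrACA -exprD subnKC// -ltnS.
Qed.

(** Each step in [i] is a convolution of at most [j.+1] products, which costs one factor [j.+1] and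
    one factor [M]. *)
Lemma pow_coef_le (a : nat -> K) (y M : K) i j : 0 <= M ->
  (forall m, (m <= j)%N -> `|power_terms a y m| <= M) ->
  `|power_terms (pow_coef a i) y j| <= j.+1%:R ^+ i * M ^+ i.
Proof.
move=> M0; elim: i j => [|i IH] j aM.
  rewrite /power_terms !expr0 mulr1 /=.
  by case: j aM => [|j] _; rewrite ?expr0 ?mul1r ?normr1// mul0r normr0.
rewrite {1}/power_terms pow_coef_power_terms.
apply: le_trans (ler_norm_sum _ _ _) _.
apply: (@le_trans _ _ (\sum_(l < j.+1) j.+1%:R ^+ i * M ^+ i * M)).
  apply: ler_sum => l _; rewrite normrM ler_pM// ?aM ?leq_subr//.
  have lj : (l <= j)%N by rewrite -ltnS.
  apply: le_trans (IH l _) _ => [m ml|].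
    by rewrite aM// (leq_trans ml).
  by rewrite ler_wpM2r ?exprn_ge0// lerXn2r ?nnegrE ?ler0n// ler_nat.
by rewrite sumr_const card_ord -[leLHS]mulr_natl [_ ^+ i.+1]exprS [M ^+ i.+1]exprSr !mulrA.
Qed.

(** If X divides S(X), then X^i divides S(X)^i. In the convolution, an index [l >= i] forces
    [l = j], leaving the factor [a 0]. *)
Lemma pow_coef_eq0 (a : nat -> K) i j : a 0%N = 0 -> (j < i)%N ->
  pow_coef a i j = 0.
Proof.
move=> a0; elim: i j => // i IH j ji /=; apply: big1 => l _.
have [li|il] := ltnP l i; first by rewrite IH// mul0r.
by rewrite (_ : (j - l)%N = 0%N) ?a0 ?mulr0//; lia.
Qed.

(** Take y = M / (M + A), where A is the sum of |a_l| for l <= j. Since y <= 1, for 0 < m <= j the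
    term is at most A y <= M. *)
Lemma exists_small_point (a : nat -> K) (M : K) j : 0 < M -> `|a 0%N| <= M ->
  exists2 y, 0 < y & forall m, (m <= j)%N -> `|power_terms a y m| <= M.
Proof.
move=> M0 a0M; pose A := \sum_(l < j.+1) `|a l|.
have A0 : 0 <= A by rewrite sumr_ge0.
have MA0 : 0 < M + A by rewrite ltr_wpDr.
have y0 : 0 < M / (M + A) by rewrite divr_gt0.
exists (M / (M + A)) => // l lj.
rewrite /power_terms normrM normrX (gtr0_norm y0).
case: l lj => [|l] lj; first by rewrite expr0 mulr1.
have y1 : M / (M + A) <= 1 by rewrite ler_pdivrMr// mul1r lerDl.
apply: (@le_trans _ _ (`|a l.+1| * (M / (M + A)))).
  by rewrite ler_wpM2l// exprS ler_piMr ?exprn_ile1// ltW.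
rewrite mulrCA ler_piMr ?(ltW M0)// ler_pdivrMr// mul1r.
apply: (@le_trans _ _ A); last by rewrite lerDr ltW.
have lj' : (l.+1 < j.+1)%N by [].
rewrite /A (bigD1 (Ordinal lj'))//= lerDl.
by rewrite sumr_ge0.
Qed.

End Series.

(** * Series in a complete field with an infinite element *)

Section NonArchimedeanSeries.

Variables (K : realFieldType) (w : K).
Hypothesis natr_le_w : forall n : nat, n%:R <= w.
Hypothesis K_complete : cauchy_complete K.

Implicit Types (u v : nat -> K) (t : nat -> nat -> K) (d e l : K).

Let w_gt0 : 0 < w.
Proof. exact: lt_le_trans ltr01 (natr_le_w 1). Qed.

(** The number of terms is at most [w], so the bound does not depend on [m] and [n]. *)
Lemma normr_sum_nat_le u d m n : 0 <= d ->
  (forall i, (m <= i < n)%N -> `|u i| <= d) ->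
  `|\sum_(m <= i < n) u i| <= d * w.
Proof.
move=> d0 ud; apply: le_trans (ler_norm_sum _ _ _) _.
rewrite big_nat; apply: (@le_trans _ _ (\sum_(m <= i < n | (m <= i < n)%N) d)).
  by apply: ler_sum => i; exact: ud.
by rewrite -big_nat sumr_const_nat -mulr_natr ler_wpM2l.
Qed.

Lemma cvg_series_null u : u @ \oo --> 0 -> cvgn (series u).
Proof.
move=> u0; apply: K_complete; apply/cauchy_seriesP => e e0.
have d0 : 0 < e / 2 / w by rewrite !divr_gt0.
have [N uN] := null_norm_le u0 d0.
exists ([set n | (N <= n)%N], setT).
  by split; [exists N | exact: filterT].
move=> [m n] [/= Nm _]; apply: (@le_lt_trans _ _ (e / 2)); last first.
  by rewrite ltr_pdivrMr// ltr_pMr// ltr1n.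
rewrite -[leRHS](divfK (lt0r_neq0 w_gt0)).
apply: normr_sum_nat_le => [|i /andP[mi _]]; first exact: ltW.
exact/uN/(leq_trans Nm).
Qed.

Lemma series_tail_le u l d N : 0 <= d -> series u @ \oo --> l ->
  (forall n, (N <= n)%N -> `|u n| <= d) -> `|l - series u N| <= d * w.
Proof.
move=> d0 ul ud.
have dl : `|series u n - series u N| @[n --> \oo] --> `|l - series u N|.
  by apply: cvg_norm; apply: cvgB => //; exact: cvg_cst.
apply: cvgr_to_le dl _; exists N => // n /= Nn.
rewrite sub_series_geq//; apply: normr_sum_nat_le => // i /andP[Ni _].
exact: ud.
Qed.

(** The square sums are the common ground between summing by rows and by columns: transposing the
    family leaves them unchanged. *)
Lemma cvg_square_sums t (r : nat -> K) : double_null t ->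
  (forall i, series (t i) @ \oo --> r i) ->
  exists2 l : K, series r @ \oo --> l &
    \sum_(0 <= i < n) \sum_(0 <= j < n) t i j @[n --> \oo] --> l.
Proof.
move=> t0 tr.
have rw d N : 0 <= d -> (forall i j, (N <= i)%N -> `|t i j| <= d) ->
    forall i, (N <= i)%N -> `|r i| <= d * w.
  move=> d0 td i Ni.
  have := @series_tail_le (t i) (r i) d 0 d0 (tr i) (fun j _ => td i j Ni).
  by rewrite /series/= big_geq// subr0.
have r0 : r @ \oo --> 0.
  apply/cvgr0Pnorm_le => e e0.
  have d0 : 0 < e / w by rewrite divr_gt0.
  have [N tN] := t0 _ d0.
  exists N => // i /= Ni; rewrite -[leRHS](divfK (lt0r_neq0 w_gt0)).
  by apply: (rw _ N) Ni => [|? j Ni]; [exact: ltW | rewrite tN ?Ni].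
have [l rl] : exists l : K, series r @ \oo --> l.
  by exists (limn (series r)); exact: cvg_series_null.
exists l => //; apply/cvgrPdist_le => e e0.
(* Two errors share e: the tail of [r], and the tails of the first [n] rows. Each is a sum of sums,
   hence the two divisions by [w]. *)
pose d := e / 2 / w / w.
have d0 : 0 < d by rewrite !divr_gt0.
have dww : d * w * w = e / 2 by rewrite !divfK ?lt0r_neq0.
have [N tN] := t0 _ d0.
exists N => // n /= Nn.
rewrite -(subrKA (series r n)) [leRHS]splitr -dww.
apply: le_trans (ler_normD _ _) (lerD _ _).
  apply: series_tail_le => //; first by rewrite mulr_ge0// ltW.
  move=> i ni; apply: (rw _ N); rewrite ?(leq_trans Nn)// ?ltW// => ? j Ni.
  by rewrite tN ?Ni.
rewrite /series/= -sumrB; apply: normr_sum_nat_le => [|i _].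
  by rewrite mulr_ge0// ltW.
apply: series_tail_le (tr i) _ => [|j nj]; first exact: ltW.
by rewrite tN// (leq_trans Nn nj) orbT.
Qed.

Lemma exchange_series t (r c : nat -> K) : double_null t ->
  (forall i, series (t i) @ \oo --> r i) ->
  (forall j, series (t^~ j) @ \oo --> c j) ->
  exists2 l : K, series r @ \oo --> l & series c @ \oo --> l.
Proof.
move=> t0 tr tc.
have [l rl sl] := cvg_square_sums t0 tr.
have [l' cl' sl'] := cvg_square_sums (double_null_tr t0) tc.
exists l => //; suff -> : l = l' by [].
move: sl'; under eq_fun do rewrite exchange_big.
exact: cvg_unique sl.
Qed.

Lemma cvg_cauchy_product u v (U V : K) :
  series u @ \oo --> U -> series v @ \oo --> V ->
  series (fun j => \sum_(i < j.+1) u i * v (j - i)%N) @ \oo --> U * V.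
Proof.
move=> uU vV.
have u0 := cvg_series_cvg_0 (cvgP _ uU).
have v0 := cvg_series_cvg_0 (cvgP _ vV).
(* Truncated subtraction would give [v 0] below the diagonal, hence the test. *)
pose t i j := u i * (if (i <= j)%N then v (j - i)%N else 0).
have t0 : double_null t.
  move=> e e0.
  have [Bu Bu0 uB] := null_bounded u0.
  have [Bv Bv0 vB] := null_bounded v0.
  have [M uM] := null_norm_le u0 (divr_gt0 e0 Bv0).
  have [N vN] := null_norm_le v0 (divr_gt0 e0 Bu0).
  (* On the support, either [M <= i], or [i < M] and then [M + N <= j] gives [N <= j - i]. *)
  exists (M + N)%N => i j ij; rewrite /t.
  case: ifPn => [i_le_j|_]; last by rewrite mulr0 normr0 ltW.
  rewrite normrM; have [Mi|iM] := leqP M i.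
    by rewrite -[leRHS](divfK (lt0r_neq0 Bv0)) ler_pM// uM.
  rewrite -[leRHS](divfK (lt0r_neq0 Bu0)) mulrC ler_pM// vN//=.
  by case/orP: ij => ?; lia.
have tr i : series (t i) @ \oo --> u i * V.
  exact/series_mull/series_shift.
have tc j : series (t^~ j) @ \oo --> \sum_(i < j.+1) u i * v (j - i)%N.
  rewrite [X in _ --> X](_ : _ = \sum_(i < j.+1) t i j).
    by apply: series_finite => i ji; rewrite /t leqNgt ji mulr0.
  by apply: eq_bigr => i _; rewrite /t -ltnS ltn_ord.
have [l rl cl] := exchange_series t0 tr tc.
have UV : series (fun i => u i * V) @ \oo --> U * V.
  rewrite mulrC (_ : (fun i => u i * V) = (fun i => V * u i)).
    exact: series_mull.
  by apply/funext => i; rewrite mulrC.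
by have -> : U * V = l by exact: cvg_unique UV rl.
Qed.

Lemma cvg_pow_coef (a : nat -> K) (x k : K) i :
  series (power_terms a x) @ \oo --> k ->
  series (power_terms (pow_coef a i) x) @ \oo --> k ^+ i.
Proof.
move=> ak; elim: i => [|i IH].
  have := @series_finite K (power_terms (pow_coef a 0) x) 1.
  rewrite big_ord1 /power_terms/= !expr0 mulr1; apply => -[//|n] _.
  by rewrite mul0r.
rewrite exprSr.
have -> : power_terms (pow_coef a i.+1) x = fun j =>
    \sum_(l < j.+1) power_terms (pow_coef a i) x l * power_terms a x (j - l)%N.
  by apply/funext => j; exact: pow_coef_power_terms.
exact: cvg_cauchy_product IH ak.
Qed.

Lemma pow_coef_le_infinite (a : nat -> K) (y M : K) i j : 0 <= M ->
  (forall m, (m <= j)%N -> `|power_terms a y m| <= M) ->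
  `|power_terms (pow_coef a i) y j| <= w * M ^+ i.
Proof.
move=> M0 aM; apply: le_trans (pow_coef_le i M0 aM) _.
by rewrite -natrX ler_wpM2r ?exprn_ge0.
Qed.

End NonArchimedeanSeries.

(** * The substitution theorem *)

Theorem theorem6p3 (K : realFieldType)
    (K_nonarch : non_archimedean K)
    (K_complete : cauchy_complete K)
    (K_basis : countable_nbhs_basis0 K)
    (a b : nat -> K) (x k : K)
    (S_at_x : series (power_terms a x) @ \oo --> k) :
  cvgn (series (abs_power_terms a x)) /\
  forall kbar : K,
    series (abs_power_terms a x) @ \oo --> kbar ->
    cvgn (series (power_terms b kbar)) ->
    (forall j : nat, cvgn (series (expected_terms a b j))) /\
    eq_series (power_terms b k) (power_terms (expected_coef a b) x).
Proof.
have [w natr_le_w] : exists w : K, forall n : nat, n%:R <= w.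
  by have [w wP] := K_nonarch; exists w => n; exact: ltW (wP n).
have abs_termsE n : abs_power_terms a x n = `|power_terms a x n|.
  by rewrite /abs_power_terms /power_terms normrM.
split.
  apply: (cvg_series_null natr_le_w K_complete).
  rewrite (funext abs_termsE); apply/norm_cvg0P.
  exact: cvg_series_cvg_0 (cvgP _ S_at_x).
move=> kbar kbarP T_cvg.
have term_le n : `|power_terms a x n| <= kbar.
  rewrite -abs_termsE; apply: le_trans (_ : series (abs_power_terms a x) n.+1 <= _).
    rewrite /series/= big_nat_recr//= lerDr sumr_ge0// => i _.
    by rewrite abs_termsE.
  rewrite -(cvg_lim (@norm_hausdorff _ K^o) kbarP).
  apply: nondecreasing_cvgn_le (cvgP _ kbarP) _.
  by apply: nondecreasing_series => i _ _; rewrite abs_termsE.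
have kbar0 : 0 <= kbar := le_trans (normr_ge0 _) (term_le 0%N).
have a0kbar : `|a 0%N| <= kbar.
  by have := term_le 0%N; rewrite /power_terms expr0 mulr1.
(* A null sequence, by convergence of T at [kbar], that will dominate row [i] uniformly in [j]. *)
pose s i := w * `|power_terms b kbar i|.
have s0 : s @ \oo --> 0.
  rewrite -(mulr0 w); apply: cvgMl_tmp.
  by apply/norm_cvg0P; exact: cvg_series_cvg_0.
(* The point [y] is left free: it will be a small point chosen for each [j], then [x] itself. *)
have bound y i j : (forall l, (l <= j)%N -> `|power_terms a y l| <= kbar) ->
    `|b i * power_terms (pow_coef a i) y j| <= s i.
  move=> ay; have -> : s i = `|b i| * (w * kbar ^+ i).
    by rewrite /s /power_terms normrM mulrCA [`|_ ^+ i|]ger0_norm// exprn_ge0.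
  by rewrite normrM ler_wpM2l//; exact: pow_coef_le_infinite.
have expected_cvg j : cvgn (series (expected_terms a b j)).
  apply: (cvg_series_null natr_le_w K_complete).
  (* A small point requires a positive bound, so [kbar = 0] is treated apart. *)
  have := kbar0; rewrite le_eqVlt => /predU1P[kbarE|kbar_gt0].
    have a0 : a 0%N = 0.
      by apply/eqP; rewrite -normr_le0 kbarE.
    apply: cvg_near_cst; exists j.+1 => // i /= ji.
    by rewrite /expected_terms pow_coef_eq0 ?mulr0.
  have [y y0 ay] := exists_small_point j kbar_gt0 a0kbar.
  have yj0 : y ^+ j != 0 by rewrite expf_neq0 ?gt_eqF.
  have st0 : b i * power_terms (pow_coef a i) y j @[i --> \oo] --> 0.
    apply/cvgr0Pnorm_le => e e0; have [N sN] := null_norm_le s0 e0.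
    exists N => // i /= Ni; apply: le_trans (bound y i j ay) _.
    exact: le_trans (ler_norm _) (sN i Ni).
  (* With [j] fixed, [y ^+ j] is a nonzero constant and can be divided out. *)
  have -> : expected_terms a b j =
      fun i => b i * power_terms (pow_coef a i) y j * (y ^+ j)^-1.
    by apply/funext => i; rewrite /power_terms mulrA mulfK.
  by rewrite -(mul0r (y ^+ j)^-1); exact: cvgMr_tmp st0.
split=> //.
pose t i j := b i * power_terms (pow_coef a i) x j.
have tr i : series (t i) @ \oo --> power_terms b k i.
  by apply: series_mull; apply: cvg_pow_coef natr_le_w K_complete _ _ _ _ S_at_x.
have t0 : double_null t.
  apply: double_null_rows s0 _ _ => [i j|i]; first exact: bound.
  by apply: cvg_series_cvg_0; exact: cvgP (tr i).
have tc j : series (t^~ j) @ \oo --> power_terms (expected_coef a b) x j.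
  rewrite /power_terms mulrC.
  have -> : t^~ j = fun i => x ^+ j * expected_terms a b j i.
    by apply/funext => i; rewrite /t /power_terms mulrA mulrC.
  exact/series_mull/expected_cvg.
have [l bl dl] := exchange_series natr_le_w K_complete t0 tr tc.
split; [exact: cvgP bl|exact: cvgP dl|].
by rewrite (cvg_lim (@norm_hausdorff _ K^o) bl) (cvg_lim (@norm_hausdorff _ K^o) dl).
Qed.
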